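(* Let $(X,d)$ be a metric space, let $M$ be a closed nonempty proper subset of $X$, let $F:(X\setminus M,d)\to(0,\infty)$ be a $1$-Lipschitz function, let $c\ge2$, and let $h_c$ be the metric on $X\setminus M$ defined by $$h_c(x,y)=\log\left(1+c\,\frac{d(x,y)}{\sqrt{F(x)F(y)}}\right),\qquad x,y\in X\setminus M.$$ Then the identity map $1_{X\setminus M}:(X\setminus M,d)\to(X\setminus M,h_c)$ is $1$-quasiconformal.
   Context: $\log$ is the natural logarithm. $F$ is $1$-Lipschitz if $|F(x)-F(y)|\le d(x,y)$ for all $x,y\in X\setminus M$. For $c\ge2$ the function $h_c$ is a metric on $X\setminus M$. For a homeomorphism $f:(Y,\rho)\to(Z,\sigma)$ between metric spaces, $x\in Y$ and $r>0$, set $$H_f(x,r)=\frac{\sup\{\sigma(f(x),f(y)):y\in Y,\ \rho(x,y)\le r\}}{\inf\{\sigma(f(x),f(y)):y\in Y,\ \rho(x,y)\ge r\}}$$ (with $\inf\emptyset=+\infty$, and the quotient understood as $0$ in that case when the numerator is finite). For a constant $0\le H<\infty$, a map $f:(Y,\rho)\to(Z,\sigma)$ is $H$-quasiconformal if it is a homeomorphism and $\limsup_{r\to0}H_f(x,r)\le H$ for every $x\in Y$. *)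

(* Defs.v *)
From HB Require Import structures.
From mathcomp Require Import all_boot all_order all_algebra.
From mathcomp Require Import all_classical all_reals all_analysis.
From mathcomp Require Import ring lra.

Set Implicit Arguments.
Unset Strict Implicit.
Unset Printing Implicit Defensive.

Import Order.TTheory GRing.Theory Num.Theory.
Import numFieldNormedType.Exports.

Local Open Scope classical_set_scope.
Local Open Scope ring_scope.

(* The subtype topology and its balls come from the library; this instance only
   adds the distance, namely the restriction of the ambient one. *)
Section SubtypeMetric.
Context {R : realType} {X : metricType R} (A : set X).

Let sub_dist (x y : A) : R := mdist (set_val x) (set_val y).

Let sub_dist_ge0 x y : 0 <= sub_dist x y.
Proof. exact: mdist_ge0. Qed.

Let sub_dist_positivity x y : sub_dist x y = 0 -> x = y.
Proof. by move=> /mdist_positivity; exact: val_inj. Qed.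

Let ballE_sub_dist x r : ball x r = [set y : A | sub_dist x y < r].
Proof. by rewrite -initial_ballE ballEmdist. Qed.

HB.instance Definition _ := PseudoMetric_isMetric.Build R (set_type A)
  sub_dist_ge0 sub_dist_positivity ballE_sub_dist.

End SubtypeMetric.

Definition hdist {R : realType} {Y : metricType R} (F : Y -> R) (c : R)
    (x y : Y) : R :=
  ln (1 + c * (mdist x y / Num.sqrt (F x * F y))).

(* The set Y with the distance hdist F c instead of its own; the three proofs
   are parameters because they are what makes hdist F c a metric. *)
Definition hspace {R : realType} {Y : metricType R} {F : Y -> R} {c : R}
    (F_gt0 : forall x, 0 < F x)
    (F_lip : forall x y, `|F x - F y| <= mdist x y)
    (c_ge2 : 2 <= c) : Type := Y.

Section HMetric.
Context {R : realType} {Y : metricType R} {F : Y -> R} {c : R}.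
Hypotheses (F_gt0 : forall x, 0 < F x)
  (F_lip : forall x y, `|F x - F y| <= mdist x y) (c_ge2 : 2 <= c).

Let c_gt0 : 0 < c. Proof. exact: lt_le_trans c_ge2. Qed.

Let ratio_ge0 x y : 0 <= c * (mdist x y / Num.sqrt (F x * F y)).
Proof.
by rewrite mulr_ge0 ?(ltW c_gt0)// divr_ge0 ?mdist_ge0// sqrtr_ge0.
Qed.

Let hdistxx x : hdist F c x x = 0.
Proof. by rewrite /hdist mdistxx mul0r mulr0 addr0 ln1. Qed.

Let hdist_positivity x y : hdist F c x y = 0 -> x = y.
Proof.
rewrite /hdist -ln1 => /ln_inj; rewrite !posrE ltr01 ltr_pwDl ?ratio_ge0//.
move=> /(_ isT isT)/eqP.
rewrite -subr_eq0 addrAC subrr add0r mulf_eq0 gt_eqF//= mulf_eq0 invr_eq0.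
rewrite sqrtr_eq0 leNgt mulr_gt0//= orbF => /eqP; exact: mdist_positivity.
Qed.

Let hdist_sym x y : hdist F c x y = hdist F c y x.
Proof. by rewrite /hdist metric_sym mulrC [F x * _]mulrC mulrC. Qed.

Let sqrt_step (e b q : R) : 0 < e -> 0 < b -> `|e ^+ 2 - b ^+ 2| <= q ->
  e * (e - b) <= q.
Proof.
move=> e0 b0 ebq; have q0 : 0 <= q by exact: le_trans ebq.
have {}ebq := le_trans (ler_norm _) ebq.
have [eb|be] := ltP b e; first by nra.
by rewrite (le_trans _ q0)// mulr_ge0_le0 ?subr_le0// ltW.
Qed.

Let hdist_triangle z x y : hdist F c x y <= hdist F c x z + hdist F c z y.
Proof.
have onep u v : 0 < 1 + c * (mdist u v / Num.sqrt (F u * F v)).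
  by rewrite ltr_pwDl ?ratio_ge0.
rewrite /hdist -lnM ?posrE// ler_ln ?posrE ?mulr_gt0// !sqrtrM ?(ltW (F_gt0 _))//.
set a := Num.sqrt (F x); set b := Num.sqrt (F y); set e := Num.sqrt (F z).
have [a0 b0 e0] : [/\ 0 < a, 0 < b & 0 < e] by rewrite !sqrtr_gt0.
have [Ea Eb Ee] : [/\ F x = a ^+ 2, F y = b ^+ 2 & F z = e ^+ 2].
  by rewrite !sqr_sqrtr ?ltW.
have := metric_triangle x z y.
have : e * (e - a) <= mdist x z.
  by apply: sqrt_step => //; rewrite -Ee -Ea distrC.
have : e * (e - b) <= mdist z y by apply: sqrt_step => //; rewrite -Ee -Eb.
have := mdist_ge0 x z; have := mdist_ge0 z y.
move: (mdist x y) (mdist x z) (mdist z y) => d p q q0 p0 eq ep dpq.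
have -> : (1 + c * (p / (a * e))) * (1 + c * (q / (e * b))) =
  ((a * e + c * p) * (e * b + c * q) / e ^+ 2) / (a * b).
  by field; rewrite !gt_eqF.
have -> : 1 + c * (d / (a * b)) = (a * b + c * d) / (a * b).
  by field; rewrite !gt_eqF.
rewrite ler_pM2r ?invr_gt0 ?mulr_gt0// ler_pdivlMr ?exprn_gt0//.
suff : d * e ^+ 2 <= p * (e * b) + q * (a * e) + c * (p * q).
  by move=> /(ler_wpM2l (ltW c_gt0)); lra.
have dpe : d * e ^+ 2 <= (p + q) * e ^+ 2 by rewrite ler_wpM2r// sqr_ge0.
have := ler_wpM2l p0 eq; have := ler_wpM2l q0 ep.
have := ler_wpM2r (mulr_ge0 p0 q0) c_ge2.
lra.
Qed.

HB.instance Definition _ := Choice.on (hspace F_gt0 F_lip c_ge2).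
HB.instance Definition _ := isMetric.Build R (hspace F_gt0 F_lip c_ge2)
  hdistxx hdist_positivity hdist_sym hdist_triangle.

End HMetric.

Definition homeomorphism {Y Z : topologicalType} (f : Y -> Z) : Prop :=
  continuous f /\
  exists g : Z -> Y, [/\ cancel f g, cancel g f & continuous g].

(* In \bar R one has ereal_inf set0 = +oo and a / +oo = 0. The library's values
   for +oo / +oo and 0 / 0 never affect the limsup as r -> 0 of a homeomorphism:
   for small r the denominator is +oo only if the space is a point, and it is
   positive for all r > 0 because the inverse is continuous. *)
Definition dilatation {R : realType} {Y Z : metricType R} (f : Y -> Z)
    (x : Y) (r : R) : \bar R :=
  (ereal_sup [set (mdist (f x) (f y))%:E | y in [set y | (mdist x y <= r)%R]] /
   ereal_inf [set (mdist (f x) (f y))%:E | y in [set y | (r <= mdist x y)%R]])%E.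

Definition quasiconformal {R : realType} {Y Z : metricType R} (H : {nonneg R})
    (f : Y -> Z) : Prop :=
  homeomorphism f /\
  forall x : Y, (limf_esup (dilatation f x) 0^'+ <= H%:num%:E)%E.

(* Main.v *)
Require Import Defs.
From mathcomp Require Import all_boot all_order all_algebra.
From mathcomp Require Import all_classical all_reals all_analysis.
From mathcomp Require Import ring lra.

Import Order.TTheory GRing.Theory Num.Theory.
Import numFieldNormedType.Exports.

Local Open Scope classical_set_scope.
Local Open Scope ring_scope.

(** At small scales the conformal factor of the metric, c / F, is almost
    constant around each point.  Fix x and put m = F x.  Since F is
    1-Lipschitz, a point y at distance t from x has m - t <= F y <= m + t.  Both
    t |-> t / sqrt (m (m - t)) and t |-> t / sqrt (m (m + t)) are increasing, so
    the closed ball of radius r < m around x is mapped within the distance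
      G r = ln (1 + c r / sqrt (m (m - r)))
    of x, and the complement of the open ball stays at distance at least
      g r = ln (1 + c r / sqrt (m (m + r)))
    ([hdist_le_shell], [hdist_ge_shell]).  The second bound holds for every r,
    which is what controls points far from x.

    The arguments of the two logarithms compare through
    sqrt ((m + r) / (m - r)) <= (m + r) / (m - r), and the concavity of the
    logarithm passes this factor outside, so that
      G r <= (m + r) / (m - r) * g r
    ([shell_ratio]).  Hence the dilatation at scale r is at most
    (m + r) / (m - r), which tends to 1 with r.  The same bounds show that the
    two topologies agree: G r is small for small r, and a point at
    h_c-distance less than g r from x is at distance less than r. *)

(** Bernoulli's inequality in logarithmic form.  Splitting off
    1 + k u = (1 + u) (1 + (k - 1) w) with w = u / (1 + u) reduces it to the
    tangent bound ln (1 + t) <= t, used at t = (k - 1) w and at t = - w. *)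
Lemma ln1D_mul_le (R : realType) (k u : R) :
  1 <= k -> 0 <= u -> ln (1 + k * u) <= k * ln (1 + u).
Proof.
move=> k1 u0.
have u1 : 0 < 1 + u by lra.
have w0 : 0 <= u / (1 + u) by rewrite divr_ge0// ltW.
have w1 : u / (1 + u) < 1 by rewrite ltr_pdivrMr//; lra.
have kw0 : 0 <= (k - 1) * (u / (1 + u)) by rewrite mulr_ge0// subr_ge0.
(* ln (1 + u) = - ln (1 - w) >= w, where w = u / (1 + u) *)
have lnu : u / (1 + u) <= ln (1 + u).
  have := @le_ln1Dx R (- (u / (1 + u))).
  have -> : 1 + - (u / (1 + u)) = (1 + u)^-1 by field; rewrite gt_eqF.
  rewrite lnV ?posrE// lerN2; apply; lra.
have -> : 1 + k * u = (1 + u) * (1 + (k - 1) * (u / (1 + u))).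
  by field; rewrite gt_eqF.
rewrite lnM ?posrE//; last by lra.
have : ln (1 + (k - 1) * (u / (1 + u))) <= (k - 1) * (u / (1 + u)).
  by apply: le_ln1Dx; lra.
have : (k - 1) * (u / (1 + u)) <= (k - 1) * ln (1 + u).
  by rewrite ler_wpM2l// subr_ge0.
lra.
Qed.

(** Abstracts [hdist F c x y] with [mdist x y = r], [F x = m] and
    [F y = m + s], so that r and s can vary independently; the extreme cases
    allowed by the Lipschitz condition are [s = r] and [s = - r]. *)
Definition shell_dist {R : realType} (c m s r : R) : R :=
  ln (1 + c * (r / Num.sqrt (m * (m + s)))).

Lemma shell_dist_gt0 (R : realType) (c m s r : R) :
  0 < c -> 0 < m -> 0 < m + s -> 0 < r -> 0 < shell_dist c m s r.
Proof.
move=> c0 m0 ms0 r0; rewrite ln_gt0// ltrDl.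
by rewrite mulr_gt0// divr_gt0// sqrtr_gt0 mulr_gt0.
Qed.

(** The value depends on the distance a and the increment s only through
    a^2 / (m + s), in which it is nondecreasing; the hypothesis is this
    comparison with denominators cleared. *)
Lemma le_shell_dist (R : realType) (c m s t a b : R) :
  0 < c -> 0 < m -> 0 < m + s -> 0 < m + t -> 0 <= a -> 0 <= b ->
  a ^+ 2 * (m + t) <= b ^+ 2 * (m + s) ->
  shell_dist c m s a <= shell_dist c m t b.
Proof.
move=> c0 m0 ms0 mt0 a0 b0 ab; rewrite /shell_dist.
have sm : 0 < Num.sqrt m by rewrite sqrtr_gt0.
have ss : 0 < Num.sqrt (m + s) by rewrite sqrtr_gt0.
have st : 0 < Num.sqrt (m + t) by rewrite sqrtr_gt0.
have ge0 z w : 0 <= w -> 0 < m + z -> 0 <= c * (w / Num.sqrt (m * (m + z))).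
  by move=> w0 mz0; rewrite mulr_ge0 ?(ltW c0)// divr_ge0 ?sqrtr_ge0.
rewrite ler_ln ?posrE ?ltr_pwDl ?ge0// lerD2l ler_wpM2l ?(ltW c0)//.
rewrite ler_pdivrMr ?sqrtr_gt0 ?mulr_gt0// mulrAC.
rewrite ler_pdivlMr ?sqrtr_gt0 ?mulr_gt0// !sqrtrM ?(ltW m0)//.
rewrite !(mulrCA _ (Num.sqrt m)) ler_wpM2l ?(ltW sm)//.
rewrite -(@ler_pXn2r _ 2) ?nnegrE ?mulr_ge0 ?sqrtr_ge0// !exprMn.
by rewrite !sqr_sqrtr ?(ltW ms0) ?(ltW mt0).
Qed.

(** The arguments of the logarithms differ by the factor
    sqrt ((m + r) / (m - r)); bounding it by its square, which is at least 1,
    keeps square roots out of the limit. *)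
Lemma shell_ratio (R : realType) (c m r : R) :
  0 < c -> 0 < r -> r < m ->
  shell_dist c m (- r) r <= (m + r) / (m - r) * shell_dist c m r r.
Proof.
move=> c0 r0 rm; rewrite /shell_dist.
have m0 : 0 < m by lra.
have mr0 : 0 < m - r by lra.
have pr0 : 0 < m + r by lra.
have k1 : 1 <= (m + r) / (m - r) by rewrite ler_pdivlMr//; lra.
have u0 : 0 <= c * (r / Num.sqrt (m * (m + r))).
  by rewrite mulr_ge0 ?(ltW c0)// divr_ge0 ?sqrtr_ge0// ltW.
apply: le_trans (ln1D_mul_le _ _ _ k1 u0).
have v0 : 0 <= c * (r / Num.sqrt (m * (m - r))).
  by rewrite mulr_ge0 ?(ltW c0)// divr_ge0 ?sqrtr_ge0// ltW.
have ku0 := mulr_ge0 (le_trans ler01 k1) u0.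
rewrite ler_ln ?posrE ?ltr_pwDl// lerD2l (mulrCA _ c) ler_wpM2l ?(ltW c0)//.
rewrite !sqrtrM ?(ltW m0)//.
have a0 : 0 < Num.sqrt m by rewrite sqrtr_gt0.
have q0 : 0 < Num.sqrt (m - r) by rewrite sqrtr_gt0.
have p0 : 0 < Num.sqrt (m + r) by rewrite sqrtr_gt0.
have qp : Num.sqrt (m - r) <= Num.sqrt (m + r) by rewrite ler_sqrt//; lra.
rewrite -{1}(sqr_sqrtr (ltW pr0)) -{2}(sqr_sqrtr (ltW mr0)).
move: (Num.sqrt m) (Num.sqrt (m - r)) (Num.sqrt (m + r)) a0 q0 p0 qp.
move=> a q p a0 q0 p0 qp.
have -> : p ^+ 2 / q ^+ 2 * (r / (a * p)) = (r / (a * q)) * (p / q).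
  by field; rewrite !gt_eqF.
have raq0 : 0 <= r / (a * q) by rewrite ltW// divr_gt0// mulr_gt0.
by rewrite ler_peMr// ler_pdivlMr// mul1r.
Qed.

(** The extreme case is the largest distance r together with the smallest value
    of F that it allows, F x - r. *)
Lemma hdist_le_shell (R : realType) (Y : metricType R) (F : Y -> R) (c : R)
    (F_gt0 : forall x, 0 < F x)
    (F_lip : forall x y, `|F x - F y| <= mdist x y) (x y : Y) (r : R) :
  0 < c -> mdist x y <= r -> r < F x ->
  hdist F c x y <= shell_dist c (F x) (- r) r.
Proof.
move=> c0 dr rF.
have d0 := mdist_ge0 x y; have Fx := F_gt0 x; have Fy := F_gt0 y.
have [Fyx ?] := andP (etrans (esym (ler_norml _ _)) (F_lip x y)).
have -> : hdist F c x y = shell_dist c (F x) (F y - F x) (mdist x y).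
  by rewrite /hdist /shell_dist subrKC.
have m0 : 0 <= F x - r by lra.
apply: le_shell_dist => //; rewrite ?subrKC//; try lra.
by rewrite ler_pM ?sqr_ge0// ?ler_pXn2r ?nnegrE//; lra.
Qed.

(** A larger distance t allows a larger F y, but the gain t^2 in the numerator
    outweighs the denominator m + t; so the bound extends from the sphere of
    radius r to everything outside it, however far from x. *)
Lemma hdist_ge_shell (R : realType) (Y : metricType R) (F : Y -> R) (c : R)
    (F_gt0 : forall x, 0 < F x)
    (F_lip : forall x y, `|F x - F y| <= mdist x y) (x y : Y) (r : R) :
  0 < c -> 0 <= r -> r <= mdist x y ->
  shell_dist c (F x) r r <= hdist F c x y.
Proof.
move=> c0 r0 rd.
have Fx := F_gt0 x; have Fy := F_gt0 y.
have [Fyx _] := andP (etrans (esym (ler_norml _ _)) (F_lip x y)).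
have -> : hdist F c x y = shell_dist c (F x) (F y - F x) (mdist x y).
  by rewrite /hdist /shell_dist subrKC.
apply: le_shell_dist => //; rewrite ?subrKC//; try lra.
move: (mdist x y) rd Fyx => d rd Fyx.
(* the worst F y is F x + d, and r^2 (m + d) <= d^2 (m + r) since r <= d *)
apply: (@le_trans _ _ (r ^+ 2 * (F x + d))).
  by rewrite ler_wpM2l ?sqr_ge0//; lra.
have rrdd : r * r <= d * d by rewrite ler_pM.
have H1 := ler_wpM2r (ltW Fx) rrdd.
have d0 : 0 <= d by lra.
have H2 := ler_wpM2l (mulr_ge0 r0 d0) rd.
rewrite !expr2; lra.
Qed.

Lemma hspace_homeomorphism (R : realType) (Y : metricType R) (F : Y -> R)
    (c : R) (F_gt0 : forall x, 0 < F x)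
    (F_lip : forall x y, `|F x - F y| <= mdist x y) (c_ge2 : 2 <= c) :
  homeomorphism (id : Y -> hspace F_gt0 F_lip c_ge2).
Proof.
have c0 : 0 < c by lra.
split; last exists id; last split => //.
- move=> x A /nbhs_ballP[e /= e0 eA]; apply/nbhs_ballP.
  have Fx := F_gt0 x.
  (* below radius F x / 2 the shell ratio is at most 3, and
     ln (1 + u) <= u gives h <= 3 c r / F x *)
  pose r := Num.min (F x / 2) (e * F x / (6 * c)).
  have r0 : 0 < r by rewrite lt_min !divr_gt0 ?mulr_gt0//.
  have rF : r <= F x / 2 by rewrite ge_min lexx.
  have re : r <= e * F x / (6 * c) by rewrite ge_min lexx orbT.
  exists r => //= y; rewrite ballEmdist/= => dr.
  apply: eA; rewrite ballEmdist/=.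
  have rFx : r < F x by lra.
  have hG := hdist_le_shell _ _ _ _ F_gt0 F_lip _ _ _ c0 (ltW dr) rFx.
  apply: (le_lt_trans hG).
  apply: (le_lt_trans (shell_ratio _ _ _ _ c0 r0 rFx)).
  have k3 : (F x + r) / (F x - r) <= 3 by rewrite ler_pdivrMr; lra.
  have g0 : 0 < shell_dist c (F x) r r by apply: shell_dist_gt0 => //; lra.
  apply: (@le_lt_trans _ _ (3 * shell_dist c (F x) r r)).
    by rewrite ler_wpM2r// ltW.
  have gr : shell_dist c (F x) r r <= c * (r / F x).
    apply: (@le_trans _ _ (c * (r / Num.sqrt (F x * (F x + r))))).
      apply: le_ln1Dx.
      have : 0 <= c * (r / Num.sqrt (F x * (F x + r))).
        by rewrite mulr_ge0 ?(ltW c0)// divr_ge0 ?sqrtr_ge0// ltW.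
      lra.
    rewrite ler_wpM2l ?(ltW c0)// ler_wpM2l ?(ltW r0)//.
    have Fxr : 0 < F x + r by lra.
    rewrite lef_pV2 ?posrE ?sqrtr_gt0 ?mulr_gt0//.
    rewrite -{1}(gtr0_norm Fx) -sqrtr_sqr ler_sqrt; last first.
      by rewrite mulr_ge0// ltW.
    by rewrite expr2 ler_wpM2l ?(ltW Fx)//; lra.
  have : c * (r / F x) <= e / 6.
    rewrite mulrA ler_pdivrMr//.
    move: re; rewrite ler_pdivlMr ?mulr_gt0//; lra.
  lra.
- move=> x A /nbhs_ballP[e /= e0 eA]; apply/nbhs_ballP.
  have Fx := F_gt0 x.
  exists (shell_dist c (F x) e e) => /=.
    by apply: shell_dist_gt0 => //; lra.
  move=> y; rewrite ballEmdist/= => hy; apply: eA; rewrite ballEmdist/=.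
  rewrite ltNge; apply/negP => ed.
  have := hdist_ge_shell _ _ _ _ F_gt0 F_lip _ _ _ c0 (ltW e0) ed.
  by rewrite leNgt => /negP; apply.
Qed.

Lemma hspace_dilatation_le (R : realType) (Y : metricType R) (F : Y -> R)
    (c : R) (F_gt0 : forall x, 0 < F x)
    (F_lip : forall x y, `|F x - F y| <= mdist x y) (c_ge2 : 2 <= c)
    (x : Y) (r : R) : 0 < r -> r < F x ->
  (dilatation (id : Y -> hspace F_gt0 F_lip c_ge2) x r <=
     ((F x + r) / (F x - r))%:E)%E.
Proof.
move=> r0 rF; rewrite /dilatation.
have c0 : 0 < c by lra.
have Fx := F_gt0 x.
set S := ereal_sup _; set I := ereal_inf _.
have SG : (S <= (shell_dist c (F x) (- r) r)%:E)%E.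
  apply: ge_ereal_sup => _ [y /= xy <-]; rewrite lee_fin.
  exact: (hdist_le_shell _ _ _ _ F_gt0 F_lip).
have Ig : ((shell_dist c (F x) r r)%:E <= I)%E.
  apply: le_ereal_inf_tmp => _ [y /= xy <-]; rewrite lee_fin.
  by apply: (hdist_ge_shell _ _ _ _ F_gt0 F_lip) => //; exact: ltW.
have g0 : 0 < shell_dist c (F x) r r by apply: shell_dist_gt0 => //; lra.
have k0 : 0 <= (F x + r) / (F x - r) by rewrite divr_ge0//; lra.
have S0 : (0 <= S)%E.
  apply: ereal_sup_ubound; exists x => /=; last by rewrite mdistxx.
  by rewrite mdistxx ltW.
case: S S0 SG => [s||]//; rewrite !lee_fin => s0 sG.
(* no point lies at distance >= r: the quotient is 0 *)
case: I Ig => [i||]//; last by rewrite invey mule0 lee_fin.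
rewrite lee_fin => gi.
have i0 : 0 < i by rewrite (lt_le_trans g0).
rewrite inver gt_eqF// -EFinM lee_fin ler_pdivrMr//.
apply: (le_trans sG); apply: (le_trans (shell_ratio _ _ _ _ c0 r0 rF)).
by rewrite ler_wpM2l.
Qed.

Lemma limf_esup_le_near (T : choiceType) (X : filteredType T) (R : realType)
    (f : X -> \bar R) (D : set_system X) (l : \bar R) :
  (\forall t \near D, (f t <= l)%E) -> (limf_esup f D <= l)%E.
Proof.
move=> fl; rewrite limf_esupE.
apply: ge_ereal_inf; exists (ereal_sup (f @` [set t | (f t <= l)%E])).
  by exists [set t | (f t <= l)%E].
by apply: ge_ereal_sup => _ [t /= ? <-].
Qed.

Lemma hspace_quasiconformal (R : realType) (Y : metricType R) (F : Y -> R)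
    (c : R) (F_gt0 : forall x, 0 < F x)
    (F_lip : forall x y, `|F x - F y| <= mdist x y) (c_ge2 : 2 <= c) :
  quasiconformal 1%:nng (id : Y -> hspace F_gt0 F_lip c_ge2).
Proof.
split=> [|x]; first exact: hspace_homeomorphism.
have Fx := F_gt0 x.
apply/lee_addgt0Pr => e e0; apply: limf_esup_le_near.
(* (m + r) / (m - r) <= 1 + e iff (2 + e) r <= e m *)
have d0 : 0 < e * F x / (2 + e) by rewrite divr_gt0 ?mulr_gt0//; lra.
near=> r.
have r0 : 0 < r by near: r; exact: nbhs_right_gt.
have : r < e * F x / (2 + e) by near: r; exact: nbhs_right_lt.
rewrite ltr_pdivlMr; last by lra.
move=> re.
have rF : r < F x.
  by rewrite -(ltr_pM2l e0); apply: le_lt_trans re; nra.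
apply: (le_trans (hspace_dilatation_le _ _ _ _ F_gt0 F_lip c_ge2 _ _ r0 rF)).
rewrite -EFinD lee_fin ler_pdivrMr/=; lra.
Unshelve. all: by end_near. Qed.

Theorem theorem11 (R : realType) (X : metricType R) (M : set X)
  (M_closed : closed M) (M_nonempty : M !=set0) (M_proper : M `<` [set: X])
  (F : ~` M -> R) (F_gt0 : forall x, 0 < F x)
  (F_lip : forall x y : ~` M, `|F x - F y| <= mdist x y)
  (c : R) (c_ge2 : 2 <= c) :
  quasiconformal 1%:nng (id : ~` M -> hspace F_gt0 F_lip c_ge2).
Proof. exact: hspace_quasiconformal. Qed.
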